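(* For every positive integer $n$ there exists a constant $\delta_n<1$ with the following property: for every prime $p$, every finite group $G$ and every set of Sylow $p$-subgroups $P_1,\ldots,P_n$ of $G$, we have either $G_p=P_1\cup\ldots\cup P_n$ or \[|P_1\cup\ldots\cup P_n|<\delta_n|G_p|.\]
   Context: For a finite group $G$ and a prime $p$, $G_p$ denotes the set of $p$-elements of $G$, i.e. elements whose order is a power of $p$ (including the identity). *)

(* Defs.v *)
From mathcomp Require Import all_boot all_order all_algebra all_fingroup all_solvable.
From mathcomp Require Import reals.

Set Implicit Arguments.
Unset Strict Implicit.
Unset Printing Implicit Defensive.

(* [p.-elt x] says that [#[x]] is a [p]-number; for [p] prime this means that
   [#[x]] is a power of [p], so the identity is included. *)
Definition p_elements (gT : finGroupType) (G : {set gT}) (p : nat) : {set gT} :=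
  [set x in G | (p.-elt x)%g].

(* Main.v *)
Require Import Defs.
From mathcomp Require Import all_boot all_order all_algebra all_fingroup all_solvable.
From mathcomp Require Import reals.
From mathcomp Require Import zify.

(** The reason is a gap phenomenon for unions of [n] subgroups: if they do not
    cover a finite group [Q], then they miss a proportion of [Q] that is bounded
    below in terms of [n] alone ([leq_card_uncovered]).

    If some p-element [x] lies outside the union [U] of the given Sylow
    p-subgroups of [G], take a Sylow p-subgroup [Q] containing [x]. The given
    subgroups do not cover [Q], so [U] misses a fixed proportion of [Q]. All
    Sylow p-subgroups have the same order, hence [#|U| <= n * #|Q|], and so
    the set of p-elements outside [U] has size at least [#|U|] times a
    positive constant.

    For the gap phenomenon, a missed element gives a whole missed coset of the
    intersection of the subgroups. This is enough when all of them have bounded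
    index, for then so has the intersection. Otherwise one of them is so small
    that it can cover only a minor part of what the others miss, and induction
    on [n] applies. *)

Set Implicit Arguments.
Unset Strict Implicit.
Unset Printing Implicit Defensive.

Lemma leq_indexg_sub (gT : finGroupType) (D Q H : {group gT}) :
  D \subset Q -> #|D : H|%g <= #|Q : H|%g.
Proof. by move=> sDQ; apply/subset_leq_card/imsetS. Qed.

(** Poincare's bound for the index of an intersection. *)
Lemma leq_card_bigcap_index (gT : finGroupType) (I : finType) (A : {set I})
    (Q : {group gT}) (H : I -> {group gT}) :
  #|Q| <= #|Q :&: \bigcap_(i in A) H i| * \prod_(i in A) #|Q : H i|%g.
Proof.
(* Carrying a group structure for the partial intersections makes Lagrange's
   theorem applicable to them. *)
pose K (D : {set gT}) m :=
  exists2 E : {group gT}, D = E & #|Q| <= #|Q :&: E| * m.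
suff [E -> //] : K (\bigcap_(i in A) H i) (\prod_(i in A) #|Q : H i|%g).
elim/big_rec2: _ => [|i m D _ [E -> leQ]].
  by exists [set: gT]%G; rewrite ?setIT ?muln1.
exists (H i :&: E)%G => //=; apply: leq_trans leQ _.
rewrite mulnA leq_mul2r setICA [H i :&: _]setIC; apply/orP; right.
have <- : #|Q :&: E :&: H i| * #|Q :&: E : H i|%g = #|Q :&: E|.
  exact: LagrangeI (Q :&: E)%G (H i).
by rewrite leq_mul2l leq_indexg_sub ?subsetIl ?orbT.
Qed.

(** A union of [n] subgroups that is not the whole group misses at least the
    proportion [1 / gap n] of it. The step comes from the threshold
    [2 * gap n] on indices: a subgroup beyond it covers at most half of what
    [n] others miss, and [n.+1] subgroups below it have an intersection of
    index at most [(2 * gap n) ^ n.+1]. *)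
Fixpoint gap n := if n is m.+1 then (2 * gap m) ^ n else 1.

Lemma gap_gt0 n : 0 < gap n.
Proof. by elim: n => // n IH; rewrite expn_gt0 muln_gt0 IH. Qed.

Lemma leq_card_uncovered (gT : finGroupType) (I : finType) (A : {set I})
    (Q : {group gT}) (H : I -> {group gT}) (x : gT) :
    x \in Q -> x \notin \bigcup_(i in A) H i ->
  #|Q| <= gap #|A| * #|Q :\: \bigcup_(i in A) H i|.
Proof.
move=> Qx; move En: #|A| => n; elim: n A En => [|n IH] A En UAx.
  move/eqP: En; rewrite cards_eq0 => /eqP->.
  by rewrite big_set0 setD0 mul1n.
have gap_n := gap_gt0 n.
case: (boolP [exists i in A, 2 * gap n <= #|Q : H i|%g]).
  case/exists_inP=> i Ai le_i; move: UAx.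
  rewrite (big_setD1 i Ai) /= inE negb_or => /andP[_ UAx].
  have An : #|A :\ i| = n by have := cardsD1 i A; rewrite Ai En; lia.
  have := IH _ An UAx; set U := \bigcup_(j in _) _ => leQ.
  have leU : #|Q :\: U| <= #|Q :\: (H i :|: U)| + #|Q :&: H i|.
    rewrite -(cardsID (H i) (Q :\: U)) addnC setDDl setUC leq_add2l.
    by apply/subset_leq_card/setSI/subsetDl.
  have LQ := LagrangeI Q (H i).
  have half : 2 * gap n * #|Q :&: H i| <= #|Q|.
    by rewrite -LQ mulnC leq_mul2l le_i orbT.
  have : #|Q| <= 2 * gap n * #|Q :\: (H i :|: U)|.
    have : gap n * #|Q :\: U| <=
           gap n * (#|Q :\: (H i :|: U)| + #|Q :&: H i|).
      by rewrite leq_mul2l leU orbT.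
    lia.
  move/leq_trans; apply; rewrite leq_mul2r; apply/orP; right.
  by rewrite /= expnS leq_pmulr // expn_gt0 muln_gt0 gap_n.
rewrite negb_exists => /forallP small.
set D := Q :&: \bigcap_(i in A) H i.
have sxD : (x *: D)%g \subset Q :\: \bigcup_(i in A) H i.
  apply/subsetP=> _ /lcosetP[d /setIP[Qd /bigcapP Hd] ->].
  rewrite inE groupM // andbT; apply: contra UAx => /bigcupP[i Ai].
  by rewrite groupMr ?Hd // => Hx; apply/bigcupP; exists i.
apply: leq_trans (leq_card_bigcap_index A Q H) _.
rewrite mulnC -/D leq_mul //; last first.
  by rewrite -(card_lcoset D x) subset_leq_card.
rewrite /= -En -prod_nat_const; apply: leq_prod => i Ai.
by have := small i; rewrite Ai /= -ltnNge => /ltnW.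
Qed.

Lemma Sylow_sub_p_elements (p : nat) (gT : finGroupType) (G P : {group gT}) :
  p.-Sylow(G)%g P -> P \subset p_elements G p.
Proof.
move=> sylP; apply/subsetP=> x Px.
by rewrite inE (subsetP (pHall_sub sylP)) ?(mem_p_elt (pHall_pgroup sylP)).
Qed.

(** The comparison goes through a single Sylow subgroup [Q] that contains a
    p-element outside the union: [#|U| <= n * #|Q|], and [Q] contributes at
    least [#|Q| / gap n] elements outside the union [U]. *)
Lemma leq_card_bigcup_Sylow (p : nat) (gT : finGroupType) (I : finType)
    (G : {group gT}) (P : I -> {group gT}) (x : gT) :
    (forall i, p.-Sylow(G)%g (P i)) ->
    x \in p_elements G p -> x \notin \bigcup_i (P i : {set gT}) ->
  #|\bigcup_i (P i : {set gT})| <=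
    #|I| * gap #|I| * #|p_elements G p :\: \bigcup_i (P i : {set gT})|.
Proof.
move=> sylP; rewrite inE => /andP[Gx px] Ux.
have [||Q sylQ] := @Sylow_superset p _ G <[x]>; rewrite ?cycle_subG //.
move=> Qx; set U := \bigcup_i _ in Ux *.
have leU : #|U| <= #|I| * #|Q|.
  rewrite -sum_nat_const /U; elim/big_rec2: _ => [|i m V _ leV].
    by rewrite cards0.
  rewrite (leq_trans (leq_card_setU _ _)) // leq_add //.
  by rewrite (card_Hall (sylP i)) (card_Hall sylQ).
apply: leq_trans leU _; rewrite -mulnA leq_mul2l; apply/orP; right.
have EU : U = \bigcup_(i in [set: I]) P i by apply: eq_bigl => i; rewrite inE.
rewrite EU in Ux; have := leq_card_uncovered Qx Ux; rewrite -EU cardsT.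
move/leq_trans; apply; rewrite leq_mul2l subset_leq_card ?orbT //.
exact/setSD/Sylow_sub_p_elements.
Qed.

Local Open Scope ring_scope.

Import Order.TTheory GRing.Theory Num.Theory.

Theorem theorem9 (R : realType) (n : nat) (n_gt0 : (0 < n)%N) :
  exists delta : R,
    delta < 1 /\
    forall (p : nat) (gT : finGroupType) (G : {group gT}) (P : 'I_n -> {group gT}),
      prime p ->
      (forall i : 'I_n, (p.-Sylow(G) (P i))%g) ->
      p_elements G p = \bigcup_(i < n) (P i : {set gT}) \/
      #|\bigcup_(i < n) (P i : {set gT})|%:R < delta * #|p_elements G p|%:R.
Proof.
(* With [m] elements outside the union and [u] inside, [u <= n * gap n * m]
   and [0 < m] give [u < k * m], that is [(k + 1) * u < k * (u + m)]. *)
pose k := (n * gap n).+1.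
exists (k%:R / k.+1%:R); split.
  by rewrite ltr_pdivrMr ?ltr0n // mul1r ltr_nat.
move=> p gT G P _ sylP; set U := \bigcup_(i < n) _.
have sUG : U \subset p_elements G p
  by apply/bigcupsP=> i _; apply: Sylow_sub_p_elements.
have [sGU | /subsetPn[x Gx Ux]] := boolP (p_elements G p \subset U).
  by left; apply/eqP; rewrite eqEsubset sGU.
right; have := leq_card_bigcup_Sylow sylP Gx Ux; rewrite -/U card_ord => leU.
rewrite mulrAC ltr_pdivlMr ?ltr0n // -!natrM ltr_nat.
have m_gt0 : (0 < #|p_elements G p :\: U|)%N.
  by apply/card_gt0P; exists x; rewrite inE Ux.
have := cardsID U (p_elements G p); rewrite (setIidPr sUG) /k => <-.
by move: leU m_gt0; set m := #|_ :\: U|; set u := #|U|; nia.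
Qed.
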